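(* Let $\mathbf p=(p_1,\dots,p_s)$ be a probability vector with at least two identical components (that is, $p_i=p_j$ for some $i\ne j$). Then there are uncountably many automorphisms of the one-sided Bernoulli shift $B^+(\mathbf p)$.
   Context: $\mathbf p=(p_1,\dots,p_s)$ has components $p_j>0$ summing to $1$. $B^+(\mathbf p)$ is the shift $T$, $(Tx)_j=x_{j+1}$, on $\{1,\dots,s\}^{\mathbf N^*}$, $\mathbf N^*=\{0,1,2,\dots\}$, with Borel $\sigma$-algebra and the product measure giving symbol $j$ weight $p_j$ in each coordinate. An automorphism of a measure-preserving system is an isomorphism of the system to itself: after deleting null sets, a measure-preserving bijection $\phi$ with $\phi T=T\phi$. Automorphisms that agree a.e. are identified. *)

(* Defs.v *)
From HB Require Import structures.
From mathcomp Require Import all_boot all_order all_algebra.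
From mathcomp Require Import all_classical all_reals all_analysis.
Set Implicit Arguments.
Unset Strict Implicit.
Unset Printing Implicit Defensive.
Import Order.TTheory GRing.Theory Num.Theory.
Local Open Scope classical_set_scope.
Local Open Scope ring_scope.

Section Automorphisms.
Context (d : measure_display) (T : measurableType d) (R : realType).
Variables (mu : {measure set T -> \bar R}) (S : T -> T).

(* A set left after deleting a null set, on which S still acts. *)
Definition full_invariant (M : set T) : Prop :=
  [/\ measurable M, mu (~` M) = 0%E & {homo S : x / M x}].

(* phi is a total function, but its values outside the full-measure set M are
   irrelevant: phi restricts to an isomorphism from (M, mu, S) to (N, mu, S). *)
Definition automorphism (phi : T -> T) : Prop :=
  exists M N : set T,
    [/\ full_invariant M, full_invariant N & set_bij M N phi] /\
    [/\ measurable_fun M phi,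
        (forall A, measurable A -> A `<=` M -> measurable (phi @` A)),
        (forall A, measurable A -> mu (M `&` phi @^-1` A) = mu A) &
        forall x, M x -> phi (S x) = S (phi x)].

Definition automorphism_class (phi : T -> T) : set (T -> T) :=
  [set psi | automorphism psi /\ psi = phi %[ae mu]].

Definition automorphism_classes : set (set (T -> T)) :=
  [set automorphism_class phi | phi in automorphism].

End Automorphisms.

(* The alphabet is 'I_s.+1 because measurable types are pointed; an alphabet
   carrying a probability vector is nonempty anyway. *)
Definition symbol_sequences (s : nat) : Type :=
  prod_topology (fun _ : nat => discrete_topology 'I_s.+1).

HB.instance Definition _ (s : nat) := Topological.on (symbol_sequences s).
HB.instance Definition _ (s : nat) :=
  isPointed.Build (symbol_sequences s) (fun=> ord0).

Definition bernoulli_space (s : nat) :=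
  g_sigma_algebraType (@open (symbol_sequences s)).

Definition bernoulli_shift (s : nat) (x : bernoulli_space s) : bernoulli_space s :=
  fun k => x k.+1.

(* The values on cylinders determine the product measure uniquely. *)
Definition is_product_measure (R : realType) (s : nat) (p : 'I_s.+1 -> R)
    (mu : probability (bernoulli_space s) R) : Prop :=
  forall (n : nat) (a : nat -> 'I_s.+1),
    mu [set x : bernoulli_space s | forall k, (k < n)%N -> x k = a k] =
    (\prod_(k < n) p (a k))%:E.

(* Main.v *)
(* Let a <> b be symbols of equal weight and e a set of integers not containing 0
   and containing no two consecutive integers. Define y = run_swap x by swapping
   a and b at coordinate k exactly when the run of b's starting at k+1 is finite
   with length in e. Given the future x_{k+1}, x_{k+2}, ..., this permutes symbols
   of equal weight, so run_swap preserves the product measure, and it commutes with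
   the shift. The condition on e makes it invertible: y_k = y_{k+1} = a forces
   x_k = a, and from such a k the earlier coordinates of x are computed backwards
   from those of y; almost every y has infinitely many such k. Different sets e
   give maps that differ on a cylinder a b^m a, and there are uncountably many e,
   for instance all sets of odd integers. *)
Require Import Defs.
From mathcomp Require Import all_boot all_order all_algebra all_fingroup.
From mathcomp Require Import all_classical all_reals all_analysis.
From mathcomp Require Import zify.
Set Implicit Arguments.
Unset Strict Implicit.
Unset Printing Implicit Defensive.
Import Order.TTheory GRing.Theory Num.Theory.
Local Open Scope classical_set_scope.
Local Open Scope ring_scope.

(** Cantor's diagonal argument: under injectivity [d] is the only sequence with code [h d], so
    [d (h d)] would be its own negation. *)
Lemma not_injective_bool_seq (h : (nat -> bool) -> nat) : ~ injective h.
Proof.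
move=> h_inj; pose d n := `[< forall f, h f = n -> ~~ f n >].
have dd : ~~ d (h d).
  by apply/negP => /[dup] dhd /asboolP /(_ d erefl); rewrite dhd.
move/negP: (dd); apply; apply/asboolP => f /h_inj ->; exact: dd.
Qed.

(** * The run swap and its inverse on individual sequences *)

Section RunSwap.
Context (A : finType) (a b : A) (e : pred nat).
Implicit Types (c : A) (x y u v w : nat -> A) (k l m n : nat).

Definition dropn n x : nat -> A := fun k => x (n + k)%N.

Definition scons c x : nat -> A := fun k => if k is k'.+1 then x k' else c.

Definition selected_run : set (nat -> A) :=
  [set x | exists m, [/\ e m, forall l, (l < m)%N -> x l = b & x m <> b]].

Definition swap_if (B : Prop) c := if `[< B >] then tperm a b c else c.

Definition run_swap x : nat -> A :=
  fun k => swap_if (selected_run (dropn k.+1 x)) (x k).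

(* The only x with x l = a for n <= l whose image agrees with y below n. *)
Fixpoint run_decode n y : nat -> A :=
  if n is n'.+1 then
    let w := run_decode n' (dropn 1 y) in scons (swap_if (selected_run w) (y 0)) w
  else fun=> a.

(** Places where decoding may start: under the conditions on [e], an [a a] in the image forces the
    preimage to have [a] at the first of the two places. *)
Definition sync_after y k : set nat :=
  [set n | [/\ (k <= n)%N, y n = a & y n.+1 = a]].

Definition synchronizing : set (nat -> A) :=
  [set y | forall k, sync_after y k !=set0].

(** Which place [xget] picks is immaterial by [run_unswapE]; the default 0 is reached only when no
    [a a] occurs from [k] on. *)
Definition run_unswap y : nat -> A :=
  fun k => run_decode (xget 0 (sync_after y k)) y k.

Lemma swap_ifK B : involutive (swap_if B).
Proof. by move=> c; rewrite /swap_if; case: asboolP => // _; rewrite tpermK. Qed.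

Lemma run_swap_scons c w :
  run_swap (scons c w) = scons (swap_if (selected_run w) c) (run_swap w).
Proof. by apply/funext => -[|k]. Qed.

(** A symbol other than [b] at [n] ends the initial run by then, so nothing beyond [n] is
    consulted. *)
Lemma selected_run_local u v n :
  (forall l, (l <= n)%N -> u l = v l) -> u n <> b ->
  selected_run u = selected_run v.
Proof.
move=> uv un; have vn : v n <> b by rewrite -uv.
have impl u1 v1 : (forall l, (l <= n)%N -> u1 l = v1 l) -> u1 n <> b ->
    selected_run u1 -> selected_run v1.
  move=> uv1 un1 [m [em run end_run]].
  have mn : (m <= n)%N by rewrite leqNgt; apply/negP => /run.
  exists m; split => //; last by rewrite -uv1.
  by move=> l lm; rewrite -uv1 ?run// (leq_trans (ltnW lm)).
by apply/propext; split; apply: impl => // l /uv.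
Qed.

Lemma selected_run_drop_local x x' k n :
  (forall l, (k < l <= n)%N -> x l = x' l) -> x n <> b -> (k < n)%N ->
  selected_run (dropn k.+1 x) = selected_run (dropn k.+1 x').
Proof.
move=> xx' xn kn; apply: (@selected_run_local _ _ (n - k.+1)).
  move=> l ln; apply: xx'; rewrite leq_addr/=.
  by rewrite -(subnKC kn) leq_add2l.
by rewrite /dropn subnKC.
Qed.

Lemma run_swap_local x x' k n :
  (forall l, (l <= n)%N -> x l = x' l) -> x n <> b -> (k < n)%N ->
  run_swap x k = run_swap x' k.
Proof.
move=> xx' xn kn; rewrite /run_swap (xx' k) ?(ltnW kn)//.
by rewrite (selected_run_drop_local (x' := x') (n := n)) // => l /andP[_ /xx'].
Qed.

(** Coordinates are recovered backwards from [n], where every earlier run has stopped: once the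
    later ones up to [n] agree, both sequences make the same swap decision, and [swap_if] with a
    fixed condition is injective. *)
Lemma run_swap_determined x x' n :
  x n <> b -> x n = x' n ->
  (forall l, (l < n)%N -> run_swap x l = run_swap x' l) ->
  forall l, (l <= n)%N -> x l = x' l.
Proof.
move=> xnb xn sw.
suff H m : forall l, (n - m <= l <= n)%N -> x l = x' l.
  by move=> l ln; apply: (H n); rewrite subnn.
elim: m => [|m IH] l /andP[ml ln].
  by rewrite subn0 in ml; have -> : l = n by apply/eqP; rewrite eqn_leq ln.
have [ltml|] := boolP (n - m <= l)%N; first by rewrite IH // ltml.
rewrite -ltnNge => lm.
have {}ln : (l < n)%N by rewrite (leq_trans lm)// leq_subr.
have := sw _ ln; rewrite /run_swap.
rewrite (selected_run_drop_local (x' := x') (n := n)) //.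
  exact: (can_inj (swap_ifK _)).
move=> r /andP[lr rn]; apply: IH; rewrite rn andbT.
by move: ml lr; lia.
Qed.

Lemma run_decode_ge n y k : (n <= k)%N -> run_decode n y k = a.
Proof. by elim: n y k => [//|n IH] y [//|k] nk /=; rewrite IH. Qed.

Lemma run_swap_decode_lt n y k : (k < n)%N -> run_swap (run_decode n y) k = y k.
Proof.
elim: n y k => [//|n IH] y k kn; rewrite [run_decode _ _]/= run_swap_scons.
by case: k kn => [|k] kn /=; [rewrite swap_ifK|rewrite IH].
Qed.

Hypothesis ab : a <> b.
Hypothesis e0 : e 0 = false.

Lemma selected_run_head x : selected_run x -> x 0 = b.
Proof. by move=> [[|m] [em run _]]; [rewrite e0 in em|exact: run]. Qed.

(** In the constant tail of [a]s every run of [b]s is empty, and [e0] rejects length 0. *)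
Lemma run_swap_decode_ge n y k : (n <= k)%N -> run_swap (run_decode n y) k = a.
Proof.
move=> nk; rewrite /run_swap run_decode_ge// /swap_if; case: asboolP => //.
by move=> /selected_run_head; rewrite /dropn run_decode_ge// addn0 ltnW.
Qed.

Hypothesis eS : forall n, e n -> ~~ e n.+1.

(** The first run is nonempty by [e0], so both runs end at the same place; their lengths are then
    consecutive, which [eS] excludes. *)
Lemma selected_run_drop1 x : selected_run x -> selected_run (dropn 1 x) -> False.
Proof.
move=> [m [em run endm]] [m' [em' run' endm']].
have mm' : m = m'.+1.
  apply/eqP; rewrite eqn_leq; apply/andP; split; rewrite leqNgt; apply/negP => h.
    exact/endm'/run.
  case: m em run endm h => [|m] em run endm h; first by rewrite e0 in em.
  exact/endm/run'.
by move: (eS em'); rewrite -mm' em.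
Qed.

(* If the run after n were selected, then x n.+1 = b, the run after n.+1 would be
   one shorter, hence not selected, and run_swap would keep x n.+1 = b. *)
Lemma run_swap_sync x n :
  run_swap x n = a -> run_swap x n.+1 = a -> x n = a.
Proof.
rewrite /run_swap => + sel; rewrite {1}/swap_if; case: asboolP => // sel'.
have xSn := selected_run_head sel'; rewrite /dropn addn0 in xSn.
have nsel : ~ selected_run (dropn n.+2 x).
  move=> h; apply: (selected_run_drop1 sel').
  by rewrite /dropn; under [X in selected_run X]funext do rewrite addnA addn1.
by move: sel; rewrite /swap_if; case: asboolP => // _; rewrite xSn => /esym.
Qed.

(** The decoding started at [n'] also has [a] at [n], because its image shows [a a] there;
    [run_swap_determined] then makes the two decodings equal up to [n]. *)
Lemma run_decode_sync n n' y k : (n < n')%N ->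
  y n = a -> y n.+1 = a -> y n' = a -> (k <= n)%N ->
  run_decode n' y k = run_decode n y k.
Proof.
move=> nn' yn ySn yn' kn.
have dn : run_decode n' y n = a.
  apply: run_swap_sync; first by rewrite run_swap_decode_lt.
  (* For [n' = n.+1] the second [a] of the image comes from the constant tail, otherwise from
     [y]. *)
  move: nn'; rewrite leq_eqVlt => /orP[/eqP <-|nn'].
    by rewrite run_swap_decode_ge.
  by rewrite run_swap_decode_lt.
apply: (run_swap_determined (n := n)) => //; rewrite ?dn ?run_decode_ge//.
move=> l ln; rewrite !run_swap_decode_lt//; exact: ltn_trans nn'.
Qed.

Lemma run_unswapE n y k : sync_after y k n -> run_unswap y k = run_decode n y k.
Proof.
move=> nk; rewrite /run_unswap; set n' := xget _ _.
have [kn' yn' ySn'] : sync_after y k n' by apply: xgetPex; exists n.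
case: nk => kn yn ySn; case: (ltngtP n n') => [nn'|nn'|-> //].
  exact: run_decode_sync.
by apply/esym; apply: run_decode_sync.
Qed.

Lemma run_swapK x : synchronizing (run_swap x) -> run_unswap (run_swap x) = x.
Proof.
move=> sy; apply/funext => k; have [n syn] := sy k.
rewrite (run_unswapE syn); case: syn => kn yn ySn.
(* Now [x] and the decoding started at [n] both have [a] at [n] and share their image below [n]. *)
have xn := run_swap_sync yn ySn.
apply: (run_swap_determined (n := n)) => //; rewrite ?run_decode_ge//.
by move=> l ln; rewrite run_swap_decode_lt.
Qed.

Lemma run_unswapK y : synchronizing y -> run_swap (run_unswap y) = y.
Proof.
(* Starting from [k.+1] makes [n] strictly larger than [k], so the [a] at [n] stops the run after
   [k], and one decoding serves all coordinates up to [n]. *)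
move=> sy; apply/funext => k; have [n [kn yn ySn]] := sy k.+1.
rewrite -[RHS](run_swap_decode_lt _ kn).
have dE l : (l <= n)%N -> run_unswap y l = run_decode n y l.
  by move=> ln; apply: run_unswapE.
by apply: (run_swap_local dE) => //; rewrite dE// run_decode_ge.
Qed.
End RunSwap.

Lemma selected_runE (A : finType) (b : A) (e : pred nat) (x : nat -> A) m :
  (forall l, (l < m)%N -> x l = b) -> x m <> b -> selected_run b e x = e m.
Proof.
move=> run endm; apply/propext; split=> [[m' [em' run' endm']]|em]; last by exists m.
by case: (ltngtP m m') => [/run'|/run|->].
Qed.

(** * Cylinders and measurability in the sequence space *)

Section BernoulliSpace.
Context (s : nat).
Local Notation X := (bernoulli_space s).
Implicit Types (c : 'I_s.+1) (w : nat -> 'I_s.+1) (A B : set X).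

Definition cylinder n w : set X := [set x | forall k, (k < n)%N -> x k = w k].

(** The empty set is included so that the family is closed under intersection. *)
Definition cylinders : set (set X) :=
  [set A | A = set0 \/ exists n w, A = cylinder n w].

(** Otherwise there are points outside [A] agreeing with [x] on ever longer prefixes; they converge
    to [x], against openness. *)
Lemma open_cylinder_sub (A : set (symbol_sequences s)) (x : X) :
  open A -> A x -> exists n, cylinder n x `<=` A.
Proof.
move=> oA Ax; apply: contrapT => /forallNP nA.
have /choice[u ux] n : exists y : X, cylinder n x y /\ ~ A y.
  by have /existsNP[y /not_implyP[]] := nA n; exists y.
suff : (u : nat -> symbol_sequences s) @ \oo --> (x : symbol_sequences s).
  move=> /(_ A); rewrite nbhs_filterE => h.
  have {}/h [n _ /(_ n)] : nbhs (x : symbol_sequences s) A.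
    by apply: open_nbhs_nbhs; split.
  by move=> /(_ (leqnn _)); apply: (ux n).2.
(* Convergence in the product is coordinatewise, and coordinate [k] of [u n] equals [x k] once
   [n > k]. *)
apply/cvg_sup => k U [V] [[W] oW <-] Wxk WU.
apply: (filterS WU); rewrite nbhs_simpl /=; exists k.+1 => // n /= kn.
by rewrite (ux n).1.
Qed.

Lemma measurable_coord k c : measurable [set x : X | x k = c].
Proof.
apply: sub_sigma_algebra.
apply: (@open_comp (symbol_sequences s) (discrete_topology 'I_s.+1) (proj k) [set c]).
  by move=> x _; exact: proj_continuous.
exact: discrete_open.
Qed.

Lemma measurable_cylinder n w : measurable (cylinder n w).
Proof.
have -> : cylinder n w = \big[setI/setT]_(k < n) [set x : X | x k = w k].
  by rewrite -(bigcap_mkord n (fun k => [set x : X | x k = w k])).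
by apply: bigsetI_measurable => k _; apply: measurable_coord.
Qed.

(** Two cylinders that meet are nested, the longer inside the shorter. *)
Lemma setI_closed_cylinders : setI_closed cylinders.
Proof.
have wlog_le n m w v : (n <= m)%N -> cylinders (cylinder n w `&` cylinder m v).
  move=> nm; have [[x [xw xv]]|] := pselect (cylinder n w `&` cylinder m v !=set0).
    right; exists m, v; apply/seteqP; split=> [y []//|y yv]; split=> // k kn.
    by rewrite yv ?(leq_trans kn)// -xv ?(leq_trans kn)// xw.
  by move=> /nonemptyPn ->; left.
move=> _ _ [->|[n [w ->]]] [->|[m [v ->]]]; rewrite ?set0I ?setI0; try by left.
case/orP: (leq_total n m) => nm; first exact: wlog_le.
by rewrite setIC; exact: wlog_le.
Qed.

Lemma sub_cylinders_measurable : cylinders `<=` @measurable _ X.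
Proof. by move=> _ [->|[n [w ->]]] //; exact: measurable_cylinder. Qed.

Lemma bernoulli_measurableE : @measurable _ X = <<s cylinders>>.
Proof.
apply/seteqP; split; last first.
  apply: smallest_sub; first exact: sigma_algebra_measurable.
  exact: sub_cylinders_measurable.
apply: smallest_sub; first exact: smallest_sigma_algebra.
move=> A oA.
(* Indexing by finite words makes the union countable; words whose cylinder is not inside [A]
   contribute the empty set. *)
pose F (t : seq 'I_s.+1) : set X :=
  cylinder (size t) (nth ord0 t) `&` [set _ | cylinder (size t) (nth ord0 t) `<=` A].
have -> : A = \bigcup_t F t.
  apply/seteqP; split=> [x Ax|x [t _ [xt tA]]]; last exact: tA.
  have [n xnA] := open_cylinder_sub oA Ax.
  exists (mkseq x n) => //; rewrite /F.
  have -> : cylinder (size (mkseq x n)) (nth ord0 (mkseq x n)) = cylinder n x.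
    apply/seteqP; split=> y; rewrite /cylinder /= size_mkseq => yx k kn.
      by rewrite yx// nth_mkseq.
    by rewrite nth_mkseq// yx.
  by split=> // k.
apply: (@countable_bigcupT_measurable _ (g_sigma_algebraType cylinders)) => // t.
rewrite /F; have [tA|tA] := pselect (cylinder (size t) (nth ord0 t) `<=` A).
  rewrite (_ : [set _ | _] = setT) ?setIT; last by apply/seteqP; split.
  by apply: sub_sigma_algebra; right; exists (size t), (nth ord0 t).
by rewrite (_ : [set _ | _] = set0) ?setI0// ; apply/seteqP; split.
Qed.

Lemma measurable_fun_coord d (T : measurableType d) (D : set T) (f : T -> X) :
  (forall k c, measurable (D `&` [set t | f t k = c])) -> measurable_fun D f.
Proof.
move=> mf mD; apply: (measurability cylinders _ _ mD).
  exact: bernoulli_measurableE.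
move=> _ [_ [->|[n [w ->]]] <-]; first by rewrite preimage_set0 setI0.
pose E k := ~` D `|` (D `&` [set t | f t k = w k]).
rewrite (_ : _ `&` _ = D `&` \big[setI/setT]_(k < n) E k).
  apply: measurableI => //; apply: bigsetI_measurable => k _.
  by apply: measurableU; [exact: measurableC|exact: mf].
rewrite -(bigcap_mkord n E); apply/seteqP; split=> t [Dt ft]; split=> // k kn.
  by right; split=> //; exact: ft.
by case: (ft k kn) => // -[].
Qed.

Lemma measurable_selected_run (a b : 'I_s.+1) (e : pred nat) :
  measurable (selected_run b e : set X).
Proof.
have -> : selected_run b e = \bigcup_(m in [set m | e m])
    (cylinder m (fun=> b) `&` ~` [set x : X | x m = b]).
  apply/seteqP; split=> [x [m [em run endm]]|x [m em [run endm]]].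
    by exists m.
  by exists m; split.
apply: bigcup_measurable => m _; apply: measurableI.
  exact: measurable_cylinder.
by apply: measurableC; exact: measurable_coord.
Qed.

Lemma measurable_dropn n : measurable_fun setT (dropn n : X -> X).
Proof.
by apply: measurable_fun_coord => k c; rewrite setTI; exact: measurable_coord.
Qed.

Lemma measurable_swap_if d (T : measurableType d) a b (B : set T) (f : T -> 'I_s.+1) :
  measurable B -> (forall c, measurable (f @^-1` [set c])) ->
  forall c, measurable [set t | swap_if a b (B t) (f t) = c].
Proof.
move=> mB mf c.
have -> : [set t | swap_if a b (B t) (f t) = c] =
    (B `&` f @^-1` [set tperm a b c]) `|` (~` B `&` f @^-1` [set c]).
  apply/seteqP; split=> t /=; rewrite /swap_if; case: asboolP => Bt.
  - by move=> <-; left; rewrite tpermK.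
  - by right.
  - by case=> -[_ //]; move=> ->; rewrite tpermK.
  - by case=> -[].
by apply: measurableU; apply: measurableI => //; exact: measurableC.
Qed.

Lemma measurable_run_swap a b e : measurable_fun setT (run_swap a b e : X -> X).
Proof.
apply: measurable_fun_coord => k c; rewrite setTI; move: c.
apply: (@measurable_swap_if _ X a b
  [set x | selected_run b e (dropn k.+1 x)] (fun x => x k)).
  rewrite -[X in measurable X]setTI.
  by apply: measurable_dropn => //; exact: measurable_selected_run.
by move=> c; exact: measurable_coord.
Qed.

Lemma measurable_run_decode a b e n : measurable_fun setT (run_decode a b e n : X -> X).
Proof.
elim: n => [|n IH]; first exact: measurable_cst.
have mD : measurable_fun setT (run_decode a b e n \o dropn 1 : X -> X).
  exact: (measurableT_comp IH (measurable_dropn 1)).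
apply: measurable_fun_coord => -[|k] c; rewrite setTI; last first.
  rewrite -[X in measurable X]setTI.
  exact: (mD measurableT _ (measurable_coord k c)).
apply: (@measurable_swap_if _ X a b
  [set y | selected_run b e (run_decode a b e n (dropn 1 y))] (fun y => y 0)).
  rewrite -[X in measurable X]setTI.
  by apply: mD => //; exact: measurable_selected_run.
by move=> c'; exact: measurable_coord.
Qed.

Lemma measurable_sync_after a k n : measurable [set y : X | sync_after a y k n].
Proof.
have [kn|kn] := boolP (k <= n)%N; last first.
  rewrite (_ : [set _ | _] = set0)//; apply/seteqP; split=> // y [].
  by rewrite (negbTE kn).
rewrite (_ : [set _ | _] = [set y : X | y n = a] `&` [set y : X | y n.+1 = a]).
  by apply: measurableI; exact: measurable_coord.
by apply/seteqP; split=> [y []|y []].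
Qed.

Lemma measurable_synchronizing a : measurable (synchronizing a : set X).
Proof.
rewrite (_ : synchronizing a = \bigcap_k \bigcup_n [set y : X | sync_after a y k n]).
  apply: bigcap_measurable => // k _; apply: bigcup_measurable => n _.
  exact: measurable_sync_after.
apply/seteqP; split=> y sy k; first by case: (sy k) => n ?; exists n.
by case: (sy k I) => n _ ?; exists n.
Qed.

Lemma measurable_run_unswap a b e : a <> b -> e 0 = false ->
  (forall n, e n -> ~~ e n.+1) ->
  measurable_fun (synchronizing a : set X) (run_unswap a b e : X -> X).
Proof.
move=> ab e0 eS.
apply: measurable_fun_coord => k c.
(* Any synchronizing place gives the same value, so the choice made by [xget] is replaced by a
   countable union over all places. *)
rewrite (_ : _ `&` _ = synchronizing a `&` \bigcup_m
   ([set y : X | sync_after a y k m] `&` [set y : X | run_decode a b e m y k = c])).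
  apply: measurableI; first exact: measurable_synchronizing.
  apply: bigcup_measurable => m _; apply: measurableI.
    exact: measurable_sync_after.
  rewrite -[X in measurable X]setTI.
  exact: (measurable_run_decode a b e m measurableT (measurable_coord k c)).
apply/seteqP; split=> y [sy] /=.
  have [m ym] := sy k; rewrite (run_unswapE ab e0 eS ym) => yc.
  by split=> //; exists m.
by move=> [m _ [ym yc]]; split=> //; rewrite (run_unswapE ab e0 eS ym).
Qed.
End BernoulliSpace.

(** * Invariance of the product measure and the null set of non-synchronizing sequences *)

Section ProductMeasure.
Context (R : realType) (s : nat).
Local Notation X := (bernoulli_space s).

(** Uniqueness of finite measures on a generating family closed under intersection; the whole space
    is the cylinder of length 0. *)
Lemma measure_eq_cylinder (m1 m2 : {measure set X -> \bar R}) :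
  (m1 setT < +oo)%E -> (forall n w, m1 (cylinder n w) = m2 (cylinder n w)) ->
  forall A, measurable A -> m1 A = m2 A.
Proof.
move=> m1T m12 A; rewrite [in X in X -> _]bernoulli_measurableE.
have cylT : setT = cylinder (s := s) 0 (fun=> ord0).
  by apply/seteqP; split=> // x _ k; rewrite ltn0.
have uniq := @g_sigma_algebra_measure_unique _ R X (@cylinders s)
  (@sub_cylinders_measurable s) (fun=> setT) _ _ m1 m2.
apply: uniq => //.
- by move=> _; right; exists 0%N, (fun=> ord0).
- by apply/seteqP; split=> // x _; exists 0%N.
- exact: setI_closed_cylinders.
- by move=> _ [->|[n [w ->]]]; rewrite ?measure0.
Qed.

Context (p : 'I_s.+1 -> R) (mu : probability X R).
Hypothesis p_ge0 : forall c, 0 <= p c.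
Hypothesis mu_prod : is_product_measure p mu.

Lemma mu_cylinder n w : mu (cylinder n w) = (\prod_(k < n) p (w k))%:E.
Proof. exact: mu_prod. Qed.

(** Coordinate 0 is independent of the future: as functions of [B], both sides are finite measures
    that agree on cylinders. *)
Lemma mu_coord_dropn c (B : set X) : measurable B ->
  mu ([set x | x 0%N = c] `&` dropn 1 @^-1` B) = ((p c)%:E * mu B)%E.
Proof.
move=> mB; have mc := measurable_coord (s := s) 0%N c.
pose m1 : {measure set X -> \bar R} :=
  measure_function_pushforward__canonical__measure_function_Measure
   (mrestr mu mc) (@measurable_dropn s 1).
pose m2 : {measure set X -> \bar R} := mscale (NngNum (p_ge0 c)) mu.
rewrite setIC; apply: (@measure_eq_cylinder m1 m2) => //.
  rewrite (le_lt_trans (probability_le1 mu _)) ?ltry//.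
  by apply: measurableI => //; rewrite preimage_setT.
move=> n w; rewrite /m1 /m2 /= /mscale /pushforward /mrestr /= mu_cylinder.
have -> : dropn 1 @^-1` cylinder n w `&` [set x | x 0%N = c] =
    cylinder n.+1 (scons c w).
  apply/seteqP; split=> [x [xw xc] [|k] //|x xw]; first exact: xw.
  by split=> [k kn|]; [exact: (xw k.+1)|exact: (xw 0%N)].
by rewrite mu_cylinder big_ord_recl EFinM.
Qed.

Hypothesis p_sum1 : \sum_c p c = 1.

Lemma mu_dropn1 (B : set X) : measurable B -> mu (dropn 1 @^-1` B) = mu B.
Proof.
move=> mB.
have mdB : measurable (dropn 1 @^-1` B : set X).
  by rewrite -[X in measurable X]setTI; exact: measurable_dropn.
have -> : dropn 1 @^-1` B =
    \big[setU/set0]_(c < s.+1) ([set x : X | x 0%N = c] `&` dropn 1 @^-1` B).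
  rewrite -bigcup_mkord_ord; apply/seteqP; split.
    move=> x Bx; exists (x 0%N); first exact: ltn_ord.
    by rewrite /= inord_val.
  by move=> x [c _ []].
rewrite measure_bigsetU_ord.
- rewrite (eq_bigr (fun c => (p c)%:E * mu B)%E); last first.
    by move=> c _; exact: mu_coord_dropn.
  rewrite -ge0_sume_distrl; last by move=> c _; rewrite lee_fin.
  by rewrite sumEFin p_sum1 mul1e.
- by move=> c; apply: measurableI => //; exact: measurable_coord.
- by apply/trivIsetP => c c' _ _; apply: contraNeq => /set0P[x [[/= <- _] [<- _]]].
Qed.

Lemma mu_dropn n (B : set X) : measurable B -> mu (dropn n @^-1` B) = mu B.
Proof.
move=> mB; elim: n => [//|n IH]; rewrite -[RHS]IH.
have mnB : measurable (dropn n @^-1` B : set X).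
  by rewrite -[X in measurable X]setTI; exact: measurable_dropn.
by rewrite -(mu_dropn1 mnB).
Qed.

Lemma mu_run_swap a b e (B : set X) : p a = p b -> measurable B ->
  mu (run_swap a b e @^-1` B) = mu B.
Proof.
move=> pab; have mf := measurable_run_swap a b e.
pose m1 : {measure set X -> \bar R} :=
  measure_function_pushforward__canonical__measure_function_Measure mu mf.
have m1E A : m1 A = mu (run_swap a b e @^-1` A) by [].
rewrite -m1E; move: B; apply: measure_eq_cylinder.
  by rewrite m1E preimage_setT (le_lt_trans (probability_le1 mu _))// ltry.
move=> n w; rewrite m1E.
transitivity (\prod_(k < n) p (w k))%:E; last exact/esym/mu_cylinder.
elim: n w => [|n IH] w.
  rewrite big_ord0 -(@probability_setT _ _ _ mu); congr (mu _).
  by apply/seteqP; split.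
pose C := run_swap a b e @^-1` cylinder n (dropn 1 w) : set X.
have mC : measurable C.
  by rewrite -[C]setTI; exact: (mf measurableT _ (measurable_cylinder _ _)).
pose H := selected_run b e : set X.
have mH : measurable H by exact: measurable_selected_run.
have mpull c (A : set X) : measurable A ->
    measurable ([set x : X | x 0%N = c] `&` dropn 1 @^-1` A).
  move=> mA; apply: measurableI; first exact: measurable_coord.
  by rewrite -[X in measurable X]setTI; exact: measurable_dropn.
(* The future alone decides whether coordinate 0 is swapped. In either case the one admissible
   symbol there has weight [p (w 0)], so this factor splits off and the induction hypothesis applies
   to [C]. *)
have -> : run_swap a b e @^-1` cylinder n.+1 w =
    ([set x | x 0%N = tperm a b (w 0%N)] `&` dropn 1 @^-1` (C `&` H)) `|`
    ([set x | x 0%N = w 0%N] `&` dropn 1 @^-1` (C `&` ~` H)).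
  apply/seteqP; split=> x.
    move=> xw; have Cx : C (dropn 1 x) by move=> k kn; exact: (xw k.+1).
    have := xw 0%N isT; rewrite /run_swap /swap_if; case: asboolP => Hx <-.
      by left; rewrite /= tpermK.
    by right.
  move=> [] [/= x0 [Cx Hx]] [_|k kn]; try exact: Cx.
    by rewrite /run_swap /swap_if asboolT// x0 tpermK.
  by rewrite /run_swap /swap_if asboolF.
have mCH : measurable (C `&` H) by exact: measurableI.
have mCnH : measurable (C `&` ~` H) by apply: measurableI => //; exact: measurableC.
rewrite (measureU _ (mpull _ _ mCH) (mpull _ _ mCnH)); last first.
  by apply/seteqP; split=> // x [[_ [_ +]] [_ [_ nH]]] => /nH.
have ptperm c : p (tperm a b c) = p c by case: tpermP => [->|->|].
transitivity ((p (tperm a b (w 0)))%:E * mu (C `&` H) +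
              (p (w 0))%:E * mu (C `&` ~` H))%E.
  by congr (_ + _)%E; exact: mu_coord_dropn.
rewrite ptperm -ge0_muleDr ?measure_ge0//.
have -> : (mu (C `&` H) + mu (C `&` ~` H) = mu C)%E.
  by rewrite -[in RHS](setIT C) -(setUv H) setIUr measureU// setIACA setICr setI0.
by rewrite /C IH -EFinM big_ord_recl.
Qed.

(** A sequence in the complement has no [a a] from some [k] on, so it lies in the [k]-th shift
    preimage of [F]; by stationarity it is enough that [F] is null. *)
Lemma mu_synchronizing a : 0 < p a -> mu (~` (synchronizing a : set X)) = 0%E.
Proof.
move=> pa.
have mpull (A : set X) : measurable A -> measurable (dropn 1 @^-1` A : set X).
  by move=> mA; rewrite -[X in measurable X]setTI; exact: measurable_dropn.
have ma := measurable_coord (s := s) 0%N a.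
pose F : set X := [set x | forall n, ~ (x n = a /\ x n.+1 = a)].
have mF : measurable F.
  rewrite (_ : F = \bigcap_n ~` ([set x | x n = a] `&` [set x | x n.+1 = a])).
    apply: bigcapT_measurable => n; apply: measurableC.
    by apply: measurableI; exact: measurable_coord.
  by apply/seteqP; split=> x Fx n; [move=> _; exact: Fx|exact: (Fx n I)].
pose E : set X := [set x | x 0%N = a] `&` dropn 1 @^-1`
  ([set x | x 0%N = a] `&` dropn 1 @^-1` F).
have mE : measurable E.
  apply: (measurableI _ _ ma); apply: (mpull _); apply: (measurableI _ _ ma).
  exact: mpull.
have muF0 : mu F = 0%E.
  have muE : mu E = ((p a)%:E * ((p a)%:E * mu F))%E.
    rewrite /E mu_coord_dropn ?mu_coord_dropn//.
    by apply: measurableI => //; exact: mpull.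
  have EF : E `&` F = set0.
    by apply/seteqP; split=> // x [[x0 [x1 _]]] /(_ 0%N); apply.
  (* F and E are disjoint subsets of T^-2 F, and mu E = (p a)^2 mu F. *)
  have le : (mu (E `|` F) <= mu (dropn 1 @^-1` (dropn 1 @^-1` F)))%E.
    apply: le_measure; rewrite ?inE.
    - exact: measurableU.
    - by apply: (mpull _); exact: mpull.
    - by move=> x [[_ []]//|Fx n]; exact: (Fx n.+2).
  have muFE : mu F = (fine (mu F))%:E by rewrite fineK// fin_num_measure.
  move: le; have -> : mu (E `|` F) = (mu E + mu F)%E by exact: measureU.
  rewrite (mu_dropn1 (mpull _ mF)) (mu_dropn1 mF) muE muFE.
  have : (0 <= mu F)%E by exact: measure_ge0.
  rewrite muFE; move: (fine (mu F)) => r; rewrite -!EFinM -EFinD !lee_fin => r0 le.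
  congr EFin; apply/eqP; rewrite eq_le r0 andbT.
  have : p a * p a * r <= 0 by rewrite -mulrA -(lerD2r r) add0r.
  by rewrite pmulr_rle0// mulr_gt0.
have sub : ~` (synchronizing a : set X) `<=` \bigcup_k (dropn k @^-1` F).
  move=> x /existsNP[k nsy]; exists k => // n [xn xSn]; apply: nsy.
  by exists (k + n)%N; split; rewrite ?leq_addr// -addnS.
apply: measure_negligible.
  by apply: measurableC; exact: measurable_synchronizing.
apply: (negligibleS sub); apply: negligible_bigcup => k.
have mk : measurable (dropn k @^-1` F : set X).
  by rewrite -[X in measurable X]setTI; exact: measurable_dropn.
by apply/negligibleP => //; rewrite -muF0; exact: mu_dropn.
Qed.

End ProductMeasure.

(** * Run swaps as automorphisms, and their distinctness modulo null sets *)

Section RunSwapAutomorphism.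
Context (R : realType) (s : nat).
Local Notation X := (bernoulli_space s).
Context (p : 'I_s.+1 -> R) (mu : probability X R).
Hypothesis p_gt0 : forall c, 0 < p c.
Hypothesis p_sum1 : \sum_c p c = 1.
Hypothesis mu_prod : is_product_measure p mu.
Context (a b : 'I_s.+1).
Hypotheses (ab : a <> b) (pab : p a = p b).

Let p_ge0 c : 0 <= p c. Proof. exact: ltW. Qed.

Lemma full_invariant_synchronizing :
  full_invariant mu (@bernoulli_shift s) (synchronizing a).
Proof.
split; first exact: measurable_synchronizing.
  exact: (mu_synchronizing p_ge0 mu_prod).
(* Searching from [k.+1] on rules out place 0, so the place found can be moved back by one for the
   shifted sequence. *)
move=> y sy k; have [[|n] [kn yn ySn]] := sy k.+1; first by [].
by exists n.
Qed.

Lemma automorphism_run_swap (e : pred nat) :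
  e 0%N = false -> (forall n, e n -> ~~ e n.+1) ->
  automorphism mu (@bernoulli_shift s) (run_swap a b e).
Proof.
move=> e0 eS; pose N : set X := synchronizing a.
have fullN : full_invariant mu (@bernoulli_shift s) N := full_invariant_synchronizing.
have [mN muN invN] := fullN.
have mf := measurable_run_swap a b e.
have mpre (A : set X) : measurable A -> measurable (run_swap a b e @^-1` A : set X).
  by move=> mA; rewrite -[X in measurable X]setTI; exact: mf.
pose f : X -> X := run_swap a b e; pose g : X -> X := run_unswap a b e.
have fK x : N (f x) -> g (f x) = x by exact: run_swapK.
have gK y : N y -> f (g y) = y by exact: run_unswapK.
(* The domain is a preimage of [N], so its complement is null by invariance of the measure, and it
   inherits shift invariance because [f] commutes with the shift by computation. *)
exists (f @^-1` N), N; split; split=> //.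
- split; first exact: mpre.
    rewrite -muN; apply: (mu_run_swap p_ge0 mu_prod e pab); exact: measurableC.
  by move=> x /invN.
- split=> //.
  + by move=> x y /set_mem Nx /set_mem Ny fxy; rewrite -(fK _ Nx) -(fK _ Ny); congr g.
  + move=> y Ny; exists (g y); last exact: gK.
    by change (N (f (g y))); rewrite gK.
- exact: measurable_funS mf.
(* Forward images under [f] are preimages under its inverse [g], which is measurable on [N]. *)
- move=> A mA AM; rewrite (_ : _ @` _ = N `&` g @^-1` A).
    exact: (measurable_run_unswap ab e0 eS mN mA).
  apply/seteqP; split=> [_ [x Ax <-]|y [Ny Ay]].
    by split; [exact: AM|change (A (g (f x))); rewrite fK//; exact: AM].
  by exists (g y) => //; exact: gK.
- move=> A mA; rewrite -preimage_setI.
  transitivity (mu (N `&` A)).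
    by apply: (mu_run_swap p_ge0 mu_prod e pab); exact: measurableI.
  apply/eqP; rewrite eq_le; apply/andP; split.
    by apply: le_measure; rewrite ?inE//; exact: measurableI.
  (* Adding the null complement of [N] to the intersection of [N] and [A] covers [A]. *)
  rewrite -(measureU0 (measurableI _ _ mN mA) (measurableC mN) muN).
  apply: le_measure; rewrite ?inE//.
    apply: measurableU; [exact: measurableI|exact: measurableC].
  by move=> x Ax; have [Nx|nNx] := pselect (N x); [left|right].
Qed.

Lemma run_swap_ae_inj (e e' : pred nat) :
  (run_swap a b e : X -> X) = run_swap a b e' %[ae mu] -> e =1 e'.
Proof.
(* The word [a b^m a] has length [m.+2]; on its cylinder coordinate 0 of the image reveals whether
   [m] is selected, and the cylinder has positive measure. *)
move=> ee' m; pose w := scons a (fun l => if (l < m)%N then b else a).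
have out e1 x : cylinder m.+2 w x -> run_swap a b e1 x 0%N = if e1 m then b else a.
  move=> xw; have xS l : (l <= m)%N -> x l.+1 = w l.+1 by move=> lm; apply: xw.
  rewrite /run_swap (xw 0%N isT) /swap_if (@selected_runE _ b e1 _ m).
  - by rewrite asboolb; case: (e1 m) => //=; rewrite tpermL.
  - by move=> l lm; rewrite /dropn xS /= ?lm// ltnW.
  - by rewrite /dropn xS /= ?ltnn.
have [//|em] := eqVneq (e m) (e' m).
have : mu (cylinder m.+2 w) = 0%E.
  apply: measure_negligible; first exact: measurable_cylinder.
  apply: negligibleS ee' => x xw /= /(_ I) /(congr1 (fun y => y 0%N)).
  by rewrite !out//; move: em; case: (e m); case: (e' m) => // _ /esym.
rewrite (mu_cylinder mu_prod) => -[/eqP]; rewrite prodf_seq_eq0 => /hasP[k _ /=].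
by rewrite gt_eqF.
Qed.
End RunSwapAutomorphism.

(** * Uncountably many automorphism classes *)

Theorem proposition3p4p3 (R : realType) (s : nat) (p : 'I_s.+1 -> R)
    (p_gt0 : forall j, 0 < p j)
    (p_sum1 : \sum_j p j = 1)
    (p_rep : exists i j, i <> j /\ p i = p j)
    (mu : probability (bernoulli_space s) R)
    (mu_prod : is_product_measure p mu) :
  ~ countable (automorphism_classes mu (@bernoulli_shift s)).
Proof.
have [a [b [ab pab]]] := p_rep.
move=> /countable_injP[g g_inj].
(* The bit [f k] is stored at the odd integer [2k+1], which keeps 0 and consecutive pairs out of the
   set. *)
pose e (f : nat -> bool) : pred nat := fun n => odd n && f n./2.
have eS f n : e f n -> ~~ e f n.+1.
  by move=> /andP[on _]; rewrite /e /= on.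
pose phi f : bernoulli_space s -> bernoulli_space s := run_swap a b (e f).
have aut f : automorphism mu (@bernoulli_shift s) (phi f).
  exact: (automorphism_run_swap p_gt0 p_sum1 mu_prod ab pab erefl (eS f)).
pose h f := g (automorphism_class mu (@bernoulli_shift s) (phi f)).
apply: (@not_injective_bool_seq h) => f f' hff'.
(* Since [phi f] belongs to its own class, equality of classes makes it equal a.e. to [phi f']. *)
have /seteqP[/(_ (phi f)) + _] : automorphism_class mu (@bernoulli_shift s) (phi f) =
    automorphism_class mu (@bernoulli_shift s) (phi f').
  by apply: g_inj => //; apply/mem_set; [exists (phi f)|exists (phi f')].
case; first by split=> //; exact: ae_eq_refl.
move=> _ /(run_swap_ae_inj p_gt0 mu_prod ab) ee'.
apply/funext => k; have := ee' k.*2.+1.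
by rewrite /e /= odd_double /= uphalf_double.
Qed.
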